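(* For every integer $n\ge1$, $$D_n(1,q,t)=\frac{1}{v(1-q)}\left(\frac{1+u}{(1+uv)(1-q^2)}\right)^{n-1}\sum_{k=0}^{n}(-1)^k\left(\sum_{j=0}^{n-k}v^j\left(\binom{n}{j}\binom{n}{j+k}-\binom{n}{j-1}\binom{n}{j+k+1}\right)\right)\left(\sum_{i=0}^{k}v^iq^{i(k+1-i)}\right),$$ where $$u=\frac{1+q^2-2(1+q)t-(1+q)\sqrt{(1+q)^2-4(1+q)t}}{2(q-t(1+q))},\qquad v=\frac{(1+q)-2t-\sqrt{(1+q)^2-4t(1+q)}}{2t}.$$
   Context: For $n\in\mathbb{N}$, $[n]_{p,q}=\sum_{i+j=n-1}p^iq^j$ and $\binom{n}{k}_{p,q}=\frac{[n]_{p,q}\cdots[n-k+1]_{p,q}}{[1]_{p,q}\cdots[k]_{p,q}}$. The polynomials $D_n(p,q,t)$ ($n\ge1$) are defined by the formal power series identity $$\sum_{n\ge0}D_{n+1}(p,q,t)x^n=\cfrac{1}{1-[1]_{p,q}x-\cfrac{\binom{2}{2}_{p,q}t\,x^2}{1-[2]_{p,q}x-\cfrac{\binom{3}{2}_{p,q}t\,x^2}{1-[3]_{p,q}x-\cdots}}}$$ (level $m$ has $b_m=[m+1]_{p,q}$, $\lambda_m=\binom{m+1}{2}_{p,q}t$). Binomial coefficients with negative lower index or lower index exceeding $n$ are $0$. The square root is the branch equal to $1+q$ at $t=0$.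
   Formalization: In the formula for u the square root is multiplied by (1-q) instead of the printed (1+q): as printed u = -1 at t = 0, so for n = 2 the right side is 0 there while D_2 = 1. The identity is proved with q and t as independent indeterminates, the root being a power series in t. *)

(* Defs.v *)
From HB Require Import structures.
From mathcomp Require Import all_boot all_order all_algebra.
From mathcomp Require Import boolp.

Set Implicit Arguments.
Unset Strict Implicit.
Unset Printing Implicit Defensive.

Import GRing.Theory Num.Theory.
Local Open Scope ring_scope.

(** * Formal power series over a field, with the Cauchy product *)

Record fps (F : fieldType) := Fps { fps_coef :> nat -> F }.

Notation "{ 'fps' F }" := (fps F) (at level 0, format "{ 'fps'  F }").

Section FormalPowerSeries.
Variable F : fieldType.
Implicit Types (f g h : {fps F}) (c : F).

HB.instance Definition _ := gen_eqMixin {fps F}.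
HB.instance Definition _ := gen_choiceMixin {fps F}.

Lemma fpsP f g : (forall n, f n = g n) <-> f = g.
Proof.
split=> [|-> //]; case: f g => [f] [g] /= fg.
by congr Fps; apply/funext.
Qed.

Definition fpsC c : {fps F} := Fps (fun n => if n is 0%N then c else 0).
Definition fpsX : {fps F} := Fps (fun n => if n is 1%N then 1 else 0).

Definition fps_add f g : {fps F} := Fps (fun n => f n + g n).
Definition fps_opp f : {fps F} := Fps (fun n => - f n).
Definition fps_mul f g : {fps F} :=
  Fps (fun n => \sum_(i < n.+1) f i * g (n - i)%N).

Fact fps_addA : associative fps_add.
Proof. by move=> f g h; apply/fpsP => n /=; rewrite addrA. Qed.
Fact fps_addC : commutative fps_add.
Proof. by move=> f g; apply/fpsP => n /=; rewrite addrC. Qed.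
Fact fps_add0 : left_id (fpsC 0) fps_add.
Proof. by move=> f; apply/fpsP => -[|n] /=; rewrite add0r. Qed.
Fact fps_addN : left_inverse (fpsC 0) fps_opp fps_add.
Proof. by move=> f; apply/fpsP => -[|n] /=; rewrite addNr. Qed.

HB.instance Definition _ :=
  GRing.isZmodule.Build {fps F} fps_addA fps_addC fps_add0 fps_addN.

Let trunc m f : {poly F} := \poly_(i < m.+1) f i.

Let coef_trunc m f n : (n <= m)%N -> (trunc m f)`_n = f n.
Proof. by move=> nm; rewrite coef_poly ltnS nm. Qed.

Let fps_mulE m f g n : (n <= m)%N ->
  fps_mul f g n = (trunc m f * trunc m g)`_n.
Proof.
move=> nm /=; rewrite coefM; apply: eq_bigr => i _.
have im : (i <= m)%N by apply: leq_trans nm; rewrite -ltnS.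
by rewrite !coef_trunc // (leq_trans (leq_subr _ _)).
Qed.

Fact fps_mulC : commutative fps_mul.
Proof. by move=> f g; apply/fpsP => n; rewrite !(@fps_mulE n) // mulrC. Qed.

Fact fps_mulA : associative fps_mul.
Proof.
move=> f g h; apply/fpsP => n.
transitivity (trunc n f * (trunc n g * trunc n h))`_n.
  rewrite coefM; apply: eq_bigr => i _.
  by rewrite (@fps_mulE n) ?leq_subr // coef_trunc // -ltnS.
rewrite mulrA coefM; apply: eq_bigr => i _.
by rewrite (@fps_mulE n) ?coef_trunc ?leq_subr // -ltnS.
Qed.

Fact fps_mul1 : left_id (fpsC 1) fps_mul.
Proof.
move=> f; apply/fpsP => n /=; rewrite big_ord_recl /= mul1r subn0.
by rewrite big1 ?addr0 // => i _; rewrite mul0r.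
Qed.

Fact fps_mulDl : left_distributive fps_mul fps_add.
Proof.
move=> f g h; apply/fpsP => n /=; rewrite -big_split /=.
by apply: eq_bigr => i _; rewrite mulrDl.
Qed.

Fact fps_1neq0 : fpsC 1 != 0.
Proof. by apply/eqP => /fpsP /(_ 0%N) /= /eqP; rewrite oner_eq0. Qed.

HB.instance Definition _ := GRing.Zmodule_isComNzRing.Build {fps F}
  fps_mulA fps_mulC fps_mul1 fps_mulDl fps_1neq0.

Lemma fps_coefD f g n : (f + g) n = f n + g n. Proof. by []. Qed.
Lemma fps_coefN f n : (- f) n = - f n. Proof. by []. Qed.
Lemma fps_coef0 n : (0 : {fps F}) n = 0. Proof. by case: n. Qed.
Lemma fps_coefM f g n : (f * g) n = \sum_(i < n.+1) f i * g (n - i)%N.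
Proof. by []. Qed.
Lemma fps_coef0M f g : (f * g) 0%N = f 0%N * g 0%N.
Proof. by rewrite fps_coefM big_ord1. Qed.

Fact fpsC_is_zmod_morphism : zmod_morphism fpsC.
Proof. by move=> a b; apply/fpsP => -[|n] //=; rewrite subr0. Qed.
Fact fpsC_is_monoid_morphism : monoid_morphism fpsC.
Proof.
split=> // a b; apply/fpsP => n; rewrite fps_coefM big_ord_recl /= subn0.
rewrite big1 ?addr0 => [|i _]; last by rewrite mul0r.
by case: n => //= n; rewrite mulr0.
Qed.
HB.instance Definition _ :=
  GRing.isZmodMorphism.Build F {fps F} fpsC fpsC_is_zmod_morphism.
HB.instance Definition _ :=
  GRing.isMonoidMorphism.Build F {fps F} fpsC fpsC_is_monoid_morphism.

(* The list of the first n.+1 coefficients of the inverse of f, computed from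
   f_0 g_0 = 1 and \sum_(i <= m) f_i g_(m - i) = 0 for m > 0. *)
Fixpoint fps_inv_seq f n : seq F :=
  if n is m.+1 then
    let g := fps_inv_seq f m in
    rcons g (- (f 0%N)^-1 * \sum_(i < m.+1) f i.+1 * g`_(m - i))
  else [:: (f 0%N)^-1].

Definition fps_unit : {pred {fps F}} := fun f => f 0%N != 0.
Definition fps_inv f : {fps F} :=
  if fps_unit f then Fps (fun n => (fps_inv_seq f n)`_n) else f.

Let size_fps_inv_seq f n : size (fps_inv_seq f n) = n.+1.
Proof. by elim: n => //= n IHn; rewrite size_rcons IHn. Qed.

Let nth_fps_inv_seq f n i : (i <= n)%N ->
  (fps_inv_seq f n)`_i = (fps_inv_seq f i)`_i.
Proof.
elim: n => [|n IHn]; first by rewrite leqn0 => /eqP ->.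
rewrite leq_eqVlt => /predU1P[-> //|]; rewrite ltnS => i_n.
by rewrite -IHn //= nth_rcons size_fps_inv_seq ltnS i_n.
Qed.

Fact fps_mulVf : {in fps_unit, left_inverse 1 fps_inv *%R}.
Proof.
move=> f; rewrite -topredE /= /fps_inv => fU; rewrite fU.
rewrite mulrC; apply/fpsP => -[|n]; rewrite fps_coefM.
  by rewrite big_ord1 /= divff.
rewrite big_ord_recl /= subn0 nth_rcons size_fps_inv_seq ltnn eqxx.
rewrite mulrA mulrN divff // mulN1r; apply/eqP.
rewrite addrC subr_eq0; apply/eqP; apply: eq_bigr => i _.
by rewrite /bump /= add1n subSS [in RHS]nth_fps_inv_seq // leq_subr.
Qed.

Fact fps_unitP f g : g * f = 1 -> f \in fps_unit.
Proof.
move=> /fpsP /(_ 0%N); rewrite fps_coef0M -topredE /= /fps_unit => gf1.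
by apply: contra_eq_neq gf1 => ->; rewrite mulr0 eq_sym oner_neq0.
Qed.

Fact fps_inv_out : {in [predC fps_unit], fps_inv =1 id}.
Proof. by move=> f /negbTE; rewrite -topredE /= /fps_inv => ->. Qed.

HB.instance Definition _ := GRing.ComNzRing_hasMulInverse.Build {fps F}
  fps_mulVf fps_unitP fps_inv_out.

Lemma fps_unitE f : (f \is a GRing.unit) = (f 0%N != 0).
Proof. by []. Qed.

Fact fps_integral : GRing.integral_domain_axiom {fps F}.
Proof.
have nz f : f != 0 -> exists2 m, f m != 0 & forall i, (i < m)%N -> f i = 0.
  move=> f0; have [|m fm min_m] := @ex_minnP (fun m => f m != 0).
    apply: contrapT => all0; case/eqP: f0; apply/fpsP => m.
    rewrite fps_coef0; apply: contrapT => /eqP fm.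
    by apply: all0; exists m.
  exists m => // i; apply: contraTeq => /min_m; by rewrite -leqNgt.
move=> f g fg0; apply: contrapT => /negP; rewrite negb_or.
case/andP=> /nz[a fa ltfa] /nz[b gb ltgb].
have /fpsP /(_ (a + b)%N) := fg0.
have a_lt : (a < (a + b).+1)%N by rewrite ltnS leq_addr.
rewrite fps_coefM fps_coef0 (bigD1 (Ordinal a_lt)) //= addKn big1 => [|i].
  by rewrite addr0 => /eqP; rewrite mulf_eq0 (negbTE fa) (negbTE gb).
rewrite -val_eqE /= neq_ltn => /orP[/ltfa->|a_i]; first by rewrite mul0r.
have i_le : (i <= a + b)%N by rewrite -ltnS.
by rewrite [X in _ * X]ltgb ?mulr0 // ltn_subLR // ltn_add2r.
Qed.

HB.instance Definition _ :=
  GRing.ComUnitRing_isIntegral.Build {fps F} fps_integral.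

(* A square root of f with constant term a, where a ^+ 2 = f 0. *)
Fixpoint fps_sqrt_seq (a : F) f n : seq F :=
  if n is m.+1 then
    let g := fps_sqrt_seq a f m in
    rcons g ((f m.+1 - \sum_(i < m) g`_i.+1 * g`_(m - i)) / (a *+ 2))
  else [:: a].

Let size_fps_sqrt_seq a f n : size (fps_sqrt_seq a f n) = n.+1.
Proof. by elim: n => //= n IHn; rewrite size_rcons IHn. Qed.

Let nth_fps_sqrt_seq a f n i : (i <= n)%N ->
  (fps_sqrt_seq a f n)`_i = (fps_sqrt_seq a f i)`_i.
Proof.
elim: n => [|n IHn]; first by rewrite leqn0 => /eqP ->.
rewrite leq_eqVlt => /predU1P[-> //|]; rewrite ltnS => i_n.
by rewrite -IHn //= nth_rcons size_fps_sqrt_seq ltnS i_n.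
Qed.

Lemma fps_sqrt_exists a f : a *+ 2 != 0 -> a ^+ 2 = f 0%N ->
  exists2 s : {fps F}, s ^+ 2 = f & s 0%N = a.
Proof.
move=> a2 af; exists (Fps (fun n => (fps_sqrt_seq a f n)`_n)) => //.
apply/fpsP => -[|n]; first by rewrite expr2 fps_coef0M /= -expr2.
rewrite expr2 fps_coefM big_ord_recl big_ord_recr.
have -> : nat_of_ord (ord0 : 'I_n.+2) = 0%N by [].
have -> : nat_of_ord (lift ord0 (ord_max : 'I_n.+1)) = n.+1 by [].
rewrite subn0 subnn [fps_coef _ 0%N]/=.
set S := (X in _ + (X + _)).
have SE : S = \sum_(i < n) (fps_sqrt_seq a f n)`_i.+1
                          * (fps_sqrt_seq a f n)`_(n - i).
  apply: eq_bigr => i _.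
  have -> : nat_of_ord (lift ord0 (widen_ord (leqnSn n) i)) = i.+1 by [].
  rewrite subSS /fps_coef.
  rewrite [in RHS]nth_fps_sqrt_seq //.
  by rewrite [in X in _ = _ * X]nth_fps_sqrt_seq ?leq_subr.
rewrite {}SE; set T := (X in _ + (X + _)).
have -> : {| fps_coef := fun n => (fps_sqrt_seq a f n)`_n |} n.+1
          = (f n.+1 - T) / (a *+ 2).
  by rewrite /= nth_rcons size_fps_sqrt_seq ltnn eqxx.
set z := _ / _; have zE : z * (a *+ 2) = f n.+1 - T by rewrite divfK.
rewrite addrCA [a * z]mulrC -mulr2n -mulrnAr zE.
by rewrite addrC subrK.
Qed.

Lemma fps_sqrt_exists_unique (c : F) f :
    (2 : F) != 0 -> c != 0 -> f 0%N = c * c ->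
  exists! s : {fps F}, s ^+ 2 = f /\ s 0%N = c.
Proof.
move=> two c0 f0; have c2 : c *+ 2 != 0 by rewrite -mulr_natr mulf_neq0.
have [s s2 s0] := fps_sqrt_exists c2 (esym f0).
exists s; split=> // s' [s'2 s'0].
have /eqP : s' ^+ 2 = s ^+ 2 by rewrite s'2 s2.
rewrite eqf_sqr => /orP[/eqP -> //|/eqP s'E].
move: s'0; rewrite s'E fps_coefN s0 => /eqP.
by rewrite eq_sym -subr_eq0 opprK -mulr2n (negbTE c2).
Qed.

End FormalPowerSeries.

(** * Jacobi continued fractions *)

Section JacobiFraction.
Variables (F : fieldType) (b lam : nat -> F).

(* The continued fraction
     1 / (1 - b_m x - lam_(m+1) x^2 / (1 - b_(m+1) x - lam_(m+2) x^2 / ...))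
   starting at level m and cut after d levels. *)
Fixpoint jconvergent (d m : nat) : {fps F} :=
  if d is d'.+1 then
    (1 - fpsC (b m) * fpsX F
       - fpsC (lam m.+1) * fpsX F ^+ 2 * jconvergent d' m.+1)^-1
  else 0.

(* The x-adic limit of the convergents: the coefficient of x^n is the same in
   all the convergents of depth at least n.+1 (jconvergent_stable). *)
Definition jfraction (m : nat) : {fps F} :=
  Fps (fun n => jconvergent n.+1 m n).

Let agree k (f g : {fps F}) := forall i, (i < k)%N -> f i = g i.

Let agreeM k f f' g : agree k f f' -> agree k (f * g) (f' * g).
Proof.
move=> ff' i ik; rewrite !fps_coefM; apply: eq_bigr => j _.
by rewrite ff' // (leq_ltn_trans _ ik) // -ltnS.
Qed.

Let agreeV k (f g : {fps F}) :
  f 0%N = 1 -> g 0%N = 1 -> agree k f g -> agree k f^-1 g^-1.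
Proof.
move=> f0 g0 fg.
have fU : f \is a GRing.unit by rewrite fps_unitE f0 oner_neq0.
have gU : g \is a GRing.unit by rewrite fps_unitE g0 oner_neq0.
move=> i ik; have := @agreeM k f g (f^-1 * g^-1) fg i ik.
by rewrite mulrA divrr // mul1r mulrC mulrVK // => ->.
Qed.

Let den m (f : {fps F}) : {fps F} :=
  1 - fpsC (b m) * fpsX F - fpsC (lam m.+1) * fpsX F ^+ 2 * f.

Let den0 m f : den m f 0%N = 1.
Proof.
rewrite /den !(fps_coefD, fps_coefN) expr2 !fps_coef0M /=.
by rewrite !(mulr0, mul0r) oppr0 !addr0.
Qed.

Let agreeX k f g : agree k f g -> agree k.+1 (fpsX F * f) (fpsX F * g).
Proof.
move=> fg [|i] ik; rewrite !fps_coefM; first by rewrite !big_ord1 !mul0r.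
apply: eq_bigr => -[[|j] jP] _ /=; rewrite ?mul0r // fg //.
by rewrite subSS (leq_ltn_trans (leq_subr _ _)).
Qed.

Let agree_den m k f g : agree k f g -> agree k.+1 (den m f) (den m g).
Proof.
move=> fg i ik; rewrite /den !(fps_coefD, fps_coefN); congr (_ - _).
have E h : fpsC (lam m.+1) * fpsX F ^+ 2 * h
         = fpsX F * h * (fpsC (lam m.+1) * fpsX F).
  by rewrite expr2 mulrA -mulrA mulrC.
by rewrite !E; apply: agreeM ik; apply: agreeX.
Qed.

Lemma jconvergent_stable d d' m n :
  (n < d)%N -> (n < d')%N -> jconvergent d m n = jconvergent d' m n.
Proof.
suff stab k : forall d d' m, (k <= d)%N -> (k <= d')%N ->
    agree k (jconvergent d m) (jconvergent d' m).
  by move=> nd nd'; exact: (stab n.+1 d d' m nd nd' n (ltnSn n)).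
elim: k => [|k IHk] // [|e] [|e'] l //; rewrite !ltnS => ke ke'.
by apply: agreeV; rewrite ?den0 //; apply: agree_den; apply: IHk.
Qed.

(* jfraction satisfies the infinite system of equations displayed by the
   continued fraction. *)
Lemma jfractionE m :
  jfraction m = (1 - fpsC (b m) * fpsX F
                   - fpsC (lam m.+1) * fpsX F ^+ 2 * jfraction m.+1)^-1.
Proof.
apply/fpsP => n.
have H : agree n (jconvergent n m.+1) (jfraction m.+1).
  by move=> i i_n; apply: jconvergent_stable.
exact: (agreeV (den0 m _) (den0 m _) (agree_den m H) (ltnSn n)).
Qed.

End JacobiFraction.

(** * The polynomials D_n(p,q,t) *)

Section PQPolynomials.
Variable F : fieldType.
Implicit Types p q t : F.

Definition pq_num p q (n : nat) : F := \sum_(i < n) p ^+ i * q ^+ (n.-1 - i).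

Definition pq_binomial p q (n k : nat) : F :=
  (\prod_(i < k) pq_num p q (n - i)) / (\prod_(i < k) pq_num p q i.+1).

(* The value at p, q, t of the polynomial D_n, n >= 1. The only division is the
   one by [1][2] = p + q in the binomials, so this is meaningful for
   p + q != 0. *)
Definition Dpoly (n : nat) p q t : F :=
  jfraction (fun m => pq_num p q m.+1)
            (fun m => pq_binomial p q m.+1 2 * t) 0 n.-1.

End PQPolynomials.

Definition binz (n : nat) (k : int) : nat :=
  if k is Posz k' then 'C(n, k') else 0%N.

(** * The field Q(q)((t)), in which q and t are independent indeterminates *)

Notation Qq := {fraction {poly rat}}.
Notation Qqt := {fraction {fps Qq}}.

Definition qS : {fps Qq} := fpsC (tofrac ('X : {poly rat})).
Definition tS : {fps Qq} := fpsX Qq.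

(* s is the square root of (1+q)^2 - 4t(1+q) whose value at t = 0 is 1+q. *)
Definition sqrt_branch (s : {fps Qq}) : Prop :=
  s ^+ 2 = (1 + qS) ^+ 2 - 4 * tS * (1 + qS) /\ s 0%N = (1 + qS) 0%N.

Lemma sqrt_branch_exists_unique : exists! s, sqrt_branch s.
Proof.
have q1 : (1 + qS) 0%N != 0.
  have -> : (1 + qS) 0%N = tofrac (1 + 'X : {poly rat}).
    by rewrite tofracD tofrac1.
  rewrite tofrac_eq0; apply/eqP => /polyP /(_ 1%N).
  by rewrite coefD coef1 coefX coef0 add0r => /eqP; rewrite oner_eq0.
have two : (2 : Qq) != 0.
  rewrite -(rmorph_nat (@tofrac {poly rat})) tofrac_eq0 -polyC_natr.
  by rewrite polyC_eq0.
apply: (fps_sqrt_exists_unique two q1).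
have -> : 4 * tS * (1 + qS) = tS * (4 * (1 + qS)) by rewrite mulrCA mulrA.
rewrite fps_coefD fps_coefN (fps_coef0M tS) expr2 fps_coef0M.
by rewrite -[tS 0%N]/(0 : Qq) mul0r subr0.
Qed.

(* Main.v *)
(**
  With t = (1 + q) v / (1 + v)^2 the statement becomes rational in q and v:
  sqrt = (1 + q)(1 - v)/(1 + v), u = (q - v)/(1 - q v), and the bracket to the
  power n - 1 is 1/((1 + v)(1 - q)).  Absorbing this factor in x, the
  J-fraction has b_m = (1 + v)(1 - q^(m+1)), lam_m = v (1 - q^m)(1 - q^(m+1)).
  Put 1/x = (1 + z)(1 + v z)/z; the inner sum over j counts Motzkin paths with
  constant weights 1 + v and v, and performs this change of variable on
  coefficients.  In the variable z, the series
    S_m = \sum_(i, l) (-1)^(i+l) q^(i(l+1)) [i+m, m]_q [l+m, m]_q (v z)^i z^l,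
    T_m = \sum_(i, l) (-1)^(i+l) q^(i(l+1)) [i+m-1, i]_q [l+m, m]_q (v z)^i z^l
  satisfy Heine's contiguous relations
    S_m = (1 + z) T_(m+1) - (1 - q^(m+1)) z S_(m+1),
    T_m = (1 + v z) S_m - v (1 - q^(m+1)) z T_(m+1),
  with (1 + z) T_0 = 1.  Eliminating S_m gives the three-term recurrence of the
  J-fraction, so (1 + z) T_1 is the generating function of its moments; the case
  m = 0 of the second relation expresses it through S_0, whose coefficients are
  the sums over i of the statement.
*)
Require Import Defs.
From mathcomp Require Import all_boot all_order all_algebra.
From mathcomp Require Import ring zify.
Import GRing.Theory.
Local Open Scope ring_scope.

(** * Coefficients of products with [fpsX] and with constants *)

Section FpsCoefficients.
Variable F : fieldType.
Implicit Types (f : {fps F}) (c : F).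

Lemma fps_coefXM f n : (fpsX F * f) n = if n is n'.+1 then f n' else 0.
Proof.
case: n => [|n]; first by rewrite fps_coef0M mul0r.
rewrite fps_coefM big_ord_recl mul0r add0r big_ord_recl /= mul1r subSS subn0.
by rewrite big1 ?addr0 // => i _; rewrite mul0r.
Qed.

Lemma fps_coefCM c f n : (fpsC c * f) n = c * f n.
Proof.
rewrite fps_coefM big_ord_recl /= subn0 big1 ?addr0 // => i _.
by rewrite mul0r.
Qed.

End FpsCoefficients.

(** * J-fractions and weighted Motzkin paths *)

Section JacobiPaths.
Variables (F : fieldType) (b lam : nat -> F).
Local Notation X := (fpsX F).
Local Notation J := (jfraction b lam).

Lemma jfraction_mulE m :
  J m * (1 - fpsC (b m) * X - fpsC (lam m.+1) * X ^+ 2 * J m.+1) = 1.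
Proof.
rewrite {1}jfractionE mulVr // fps_unitE.
rewrite !(fps_coefD, fps_coefN) expr2 !fps_coef0M /=.
by rewrite !(mulr0, mul0r) oppr0 !addr0 oner_neq0.
Qed.

(* h m n is the total weight of the Motzkin paths of length n from height 0
   to height m. *)
Definition path_array (h : nat -> nat -> F) : Prop :=
  forall m, h m 0%N = (m == 0)%:R /\
  forall n, h m n.+1 = (if m is m'.+1 then h m' n else 0)
                       + b m * h m n + lam m.+1 * h m.+1 n.

Lemma path_array_unique h h' : path_array h -> path_array h' ->
  forall n m, h m n = h' m n.
Proof.
move=> H H'; elim=> [|n IHn] m; first by rewrite (H m).1 (H' m).1.
by rewrite (H m).2 (H' m).2 !IHn; case: m => [|m]; rewrite ?IHn.
Qed.

(** Cutting a path from height 0 to [m] at its last visits to the heights below [m] leaves [m] up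
    steps and, for each [i <= m], a path from [i] to [i] that stays at or above [i], counted by
    [J i]. *)
Lemma path_array_jfraction :
  path_array (fun m n => (X ^+ m * \prod_(i < m.+1) J i) n).
Proof.
set P := fun m => X ^+ m * \prod_(i < m.+1) J i.
have P0 : P 0%N = 1 + X * (fpsC (b 0%N) * P 0%N + fpsC (lam 1%N) * P 1%N).
  rewrite /P !big_ord_recr !big_ord0 /= expr0 expr1 !mul1r.
  by rewrite -[1 in RHS](jfraction_mulE 0); ring.
have PS m : P m.+1 = X * (P m + fpsC (b m.+1) * P m.+1
                            + fpsC (lam m.+2) * P m.+2).
  rewrite /P (big_ord_recr m.+2) /= (big_ord_recr m.+1) /= !exprS.
  move: (\prod_(i < m.+1) J i) => p.
  by rewrite -[X ^+ m * p in RHS]mulr1 -[1 in RHS](jfraction_mulE m.+1); ring.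
move=> m; rewrite -/(P m); split=> [|n]; rewrite -/(P m.+1).
  case: m => [|m]; first by rewrite P0 fps_coefD fps_coefXM addr0.
  by rewrite PS fps_coefXM.
case: m => [|m]; last by rewrite [in LHS]PS fps_coefXM !fps_coefD !fps_coefCM.
by rewrite [in LHS]P0 fps_coefD fps_coefXM !fps_coefD !fps_coefCM addrA.
Qed.

Lemma jfraction_path_array h : path_array h -> forall n, J 0 n = h 0%N n.
Proof.
move=> H n; rewrite (path_array_unique _ _ H path_array_jfraction).
by rewrite big_ord1 expr0 mul1r.
Qed.

End JacobiPaths.

(** * q-binomial recurrences *)

Section QBinomial.
Variables (R : comNzRingType) (q : R).

(* The q-binomial coefficient [i + m - 1 choose i]. *)
Fixpoint bq (i : nat) : nat -> R :=
  fix bq_i (m : nat) : R :=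
    match i, m with
    | 0, _ => 1
    | _.+1, 0 => 0
    | i'.+1, m'.+1 => bq_i m' + q ^+ m' * bq i' m'.+1
    end.

Lemma bq0 m : bq 0 m = 1. Proof. by case: m. Qed.
Lemma bqS0 i : bq i.+1 0 = 0. Proof. by []. Qed.
Lemma bqSS i m : bq i.+1 m.+1 = bq i.+1 m + q ^+ m * bq i m.+1.
Proof. by []. Qed.

Lemma bq1 i : bq i 1 = 1.
Proof. by elim: i => // i IHi; rewrite bqSS bqS0 add0r mul1r. Qed.

Lemma bq_col i m : (1 - q ^+ m) * bq i m.+1 = (1 - q ^+ (m + i)) * bq i m.
Proof.
elim: i m => [|i IHi] m; first by rewrite !bq0 addn0.
(* This recurrence in [i] follows from the claim at [i] and yields the claim at [i.+1]. *)
have row : (1 - q ^+ i.+1) * bq i.+1 m = (1 - q ^+ (m + i)) * bq i m.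
  elim: m => [|m IHm].
    by case: i {IHi} => [|i]; rewrite ?bqS0 ?mulr0 // expr0 subrr mul0r.
  rewrite bqSS mulrDr IHm -IHi !exprD !exprS; ring.
have := IHi m; rewrite -row bqSS => IH.
rewrite mulrDr mulrCA IH !exprD !exprS; ring.
Qed.

End QBinomial.

(** * Heine's contiguous relations *)

Section Contiguous.
Variables (F : fieldType) (q v : F).
Local Notation X := (fpsX F).
Implicit Types (a b c : nat -> nat -> F).

(* The series \sum_(i, l) a i l (v X)^i X^l. *)
Definition diag_fps a : {fps F} :=
  Fps (fun k => \sum_(i < k.+1) v ^+ i * a i (k - i)%N).

(** Lowering [l] by one costs a factor X; in [diag_fps_shiftl], lowering [i] costs v X. *)
Lemma diag_fps_shiftr a b c x c' :
  (forall i, a i 0%N = b i 0%N) ->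
  (forall i l, a i l.+1 = b i l.+1 + (c i l + x * c' i l)) ->
  diag_fps a = diag_fps b + X * (diag_fps c + fpsC x * diag_fps c').
Proof.
move=> a0 aS; apply/fpsP => -[|n]; rewrite fps_coefD fps_coefXM.
  by rewrite /= !big_ord1 addr0 a0.
rewrite fps_coefD fps_coefCM /= [x * _]mulr_sumr -big_split /= big_ord_recr.
rewrite [Y in _ = Y + _]big_ord_recr /= subnn a0 addrAC -big_split /=.
congr (_ + _); apply: eq_bigr => i _.
have i_n : (i <= n)%N by rewrite -ltnS.
rewrite subSn // aS; ring.
Qed.

Lemma diag_fps_shiftl a b c x c' :
  (forall l, a 0%N l = b 0%N l) ->
  (forall i l, a i.+1 l = b i.+1 l + (c i l + x * c' i l)) ->
  diag_fps a =
    diag_fps b + fpsC v * X * (diag_fps c + fpsC x * diag_fps c').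
Proof.
move=> a0 aS; apply/fpsP => n; rewrite fps_coefD -mulrA fps_coefCM fps_coefXM.
case: n => [|n]; first by rewrite /= !big_ord1 mulr0 addr0 a0.
rewrite fps_coefD fps_coefCM /= [x * _]mulr_sumr big_ord_recl.
rewrite [in RHS]big_ord_recl /= -big_split /= mulr_sumr -addrA -big_split /=.
congr (_ + _); first by rewrite a0.
apply: eq_bigr => i _; rewrite /bump /= add1n subSS aS exprS; ring.
Qed.

Let sgn i l : F := (-1) ^+ (i + l) * q ^+ (i * l.+1).

Let sgnSl i l : sgn i.+1 l = - q ^+ l.+1 * sgn i l.
Proof.
by rewrite /sgn addSn mulSn exprD [(-1) ^+ _.+1]exprS mulN1r !mulNr mulrCA.
Qed.

Let sgnSr i l : sgn i l.+1 = - q ^+ i * sgn i l.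
Proof.
rewrite /sgn addnS [(i * _.+2)%N]mulnS exprD [(-1) ^+ _.+1]exprS.
by rewrite mulN1r !mulNr mulrCA.
Qed.

Definition heineS m :=
  diag_fps (fun i l => sgn i l * (bq _ q i m.+1 * bq _ q l m.+1)).
Definition heineT m :=
  diag_fps (fun i l => sgn i l * (bq _ q i m * bq _ q l m.+1)).

(** Pascal's rule in [l] leaves a term with the factor [q ^+ (i + m.+1)], which [bq_col] splits into
    the two terms behind X. In [heineT_rec] the roles of [i] and [l] are exchanged. *)
Lemma heineS_rec m : heineS m =
  heineT m.+1 + X * (heineT m.+1 + fpsC (q ^+ m.+1 - 1) * heineS m.+1).
Proof.
apply: diag_fps_shiftr => [i|i l]; first by rewrite !bq0.
have W := bq_col _ q i m.+1.
rewrite sgnSr (bqSS _ q l m.+1).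
have -> : (q ^+ m.+1 - 1) * (sgn i l * (bq F q i m.+2 * bq F q l m.+2)) =
  - (sgn i l * bq F q l m.+2) * ((1 - q ^+ m.+1) * bq F q i m.+2) by ring.
rewrite W exprD; ring.
Qed.

Lemma heineT_rec m : heineT m =
  heineS m + fpsC v * X * (heineS m + fpsC (q ^+ m.+1 - 1) * heineT m.+1).
Proof.
apply: diag_fps_shiftl => [l|i l]; first by rewrite !bq0.
have W := bq_col _ q l m.+1.
rewrite sgnSl (bqSS _ q i m).
have -> : (q ^+ m.+1 - 1) * (sgn i l * (bq F q i m.+1 * bq F q l m.+2)) =
  - (sgn i l * bq F q i m.+1) * ((1 - q ^+ m.+1) * bq F q l m.+2) by ring.
rewrite W exprD !exprS; ring.
Qed.

End Contiguous.

(** * Change of variable and moments *)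

Section Moments.
Variables (F : fieldType) (q v : F).
Local Notation X := (fpsX F).

(** Total weight of the Motzkin paths of length [n] from height 0 to [k], with weights 1, 1 + v, v
    for up, level and down steps. *)
Fixpoint motzkin (n k : nat) : F :=
  if n is n'.+1 then
    (if k is k'.+1 then motzkin n' k' else 0)
    + (1 + v) * motzkin n' k + v * motzkin n' k.+1
  else (k == 0)%:R.

Lemma motzkin_gt n k : (n < k)%N -> motzkin n k = 0.
Proof.
elim: n k => [|n IHn] [|k] //=; rewrite ltnS => nk.
by rewrite !IHn ?ltnS ?(leqW, leqW nk, ltnW nk) // !mulr0 !addr0.
Qed.

Definition motzkin_tr (f : {fps F}) n := \sum_(k < n.+1) motzkin n k * f k.

Lemma motzkin_trD f g n :
  motzkin_tr (f + g) n = motzkin_tr f n + motzkin_tr g n.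
Proof.
rewrite -big_split; apply: eq_bigr => k _ /=.
by rewrite mulrDr.
Qed.

Lemma motzkin_trCM c f n : motzkin_tr (fpsC c * f) n = c * motzkin_tr f n.
Proof.
by rewrite mulr_sumr; apply: eq_bigr => k _; rewrite fps_coefCM mulrCA.
Qed.

Lemma motzkin_tr0 f : motzkin_tr f 0 = f 0%N.
Proof. by rewrite /motzkin_tr big_ord1 mul1r. Qed.

(* With 1/x = (1 + z)(1 + v z)/z, motzkin_tr expresses (1 + z)(1 + v z) f(z) as
   a series in x; the lemma is the effect of dividing by x. *)
Lemma motzkin_trS f h n :
  (1 + X) * (1 + fpsC v * X) * f = fpsC (f 0%N) + X * h ->
  motzkin_tr f n.+1 = motzkin_tr h n.
Proof.
move=> /fpsP fh.
(* These are the weights of [motzkin], transposed. *)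
have hE k : h k = f k.+1 + (1 + v) * f k + v * (if k is k'.+1 then f k' else 0).
  have := fh k.+1; rewrite fps_coefD fps_coefXM add0r => <-.
  have -> : (1 + X) * (1 + fpsC v * X) * f =
     f + X * f + fpsC v * (X * f) + X * (fpsC v * (X * f)) by ring.
  rewrite !fps_coefD !(fps_coefXM, fps_coefCM).
  by move: (if k is _.+1 then _ else _) => y; ring.
have -> : motzkin_tr h n = \sum_(k < n.+1) motzkin n k * f k.+1
    + (1 + v) * (\sum_(k < n.+1) motzkin n k * f k)
    + v * (\sum_(k < n.+1) motzkin n k * (if k : nat is k'.+1 then f k' else 0)).
  rewrite !mulr_sumr -!big_split; apply: eq_bigr => k _ /=.
  by rewrite hE; move: (if _ is _.+1 then _ else _) => y; ring.
have -> : motzkin_tr f n.+1 =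
    \sum_(k < n.+2) (if k : nat is k'.+1 then motzkin n k' else 0) * f k
    + (1 + v) * (\sum_(k < n.+2) motzkin n k * f k)
    + v * (\sum_(k < n.+2) motzkin n k.+1 * f k).
  rewrite !mulr_sumr -!big_split; apply: eq_bigr => k _ /=.
  by move: (if _ is _.+1 then _ else _) => y; ring.
congr (_ + _ * _ + _ * _).
- by rewrite big_ord_recl mul0r add0r.
- by rewrite big_ord_recr /= motzkin_gt // mul0r addr0.
rewrite 2!big_ord_recr /= !motzkin_gt // !mul0r !addr0.
by rewrite [RHS]big_ord_recl mulr0 add0r.
Qed.

Let F_ m := (1 + X) * heineT F q v m.

(** Only the terms with i = 0 survive in T_0, which is thus the expansion of 1 / (1 + X). *)
Lemma heineT0 : F_ 0 = 1.
Proof.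
rewrite /F_ mulrDl mul1r; apply/fpsP => n; rewrite fps_coefD fps_coefXM.
have T0 k : heineT F q v 0 k = (-1) ^+ k.
  rewrite /= big_ord_recl big1 => [|i _]; last by rewrite bqS0 mul0r !mulr0.
  rewrite bq0 !mul1r subn0 mul0n expr0 add0n mulr1 addr0.
  by rewrite bq1 mulr1.
rewrite T0; case: n => [|n]; first by rewrite expr0 addr0.
by rewrite T0 exprS mulN1r addNr.
Qed.

Lemma heineF_rec m :
  (1 + X) * (1 + fpsC v * X) * F_ m.+1 = F_ m
    + X * (fpsC ((1 + v) * (1 - q ^+ m.+1)) * F_ m.+1
           + fpsC (v * (1 - q ^+ m.+1) * (1 - q ^+ m.+2)) * (X * F_ m.+2)).
Proof.
rewrite /F_.
have HS := heineS_rec F q v m.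
have T1 := heineT_rec F q v m.
have T2 := heineT_rec F q v m.+1.
rewrite !(rmorphB, rmorphM, rmorphD, rmorph1) /= in HS T1 T2 *.
(* Substitution leaves a ring identity in S_(m+1) and T_(m+2) alone. *)
move: (heineS _ _ _ m) (heineS _ _ _ m.+1) HS T1 T2 => s0 s1 -> -> E.
by rewrite {}E; ring.
Qed.

Lemma coef0_heineF1 : F_ 1 0%N = 1.
Proof. by rewrite /F_ fps_coef0M /= big_ord1 /= addr0 !mul1r. Qed.

(** Multiplied by X^m, [heineF_rec] becomes the path recurrence through [motzkin_trS]; at m = 0 the
    term [F_ 0] = 1 is the constant coefficient that gets removed. *)
Lemma path_array_heine :
  path_array F (fun m => (1 + v) * (1 - q ^+ m.+1))
    (fun m => v * (1 - q ^+ m) * (1 - q ^+ m.+1))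
    (fun m => motzkin_tr (X ^+ m * F_ m.+1)).
Proof.
move=> m; split=> [|n].
  rewrite motzkin_tr0 fps_coef0M; case: m => [|m].
    by rewrite coef0_heineF1 mulr1.
  by rewrite exprS fps_coef0M !mul0r.
have E := heineF_rec m; case: m E => [|m] E.
  rewrite add0r expr0 expr1 mul1r -!motzkin_trCM -motzkin_trD.
  by apply: motzkin_trS; rewrite coef0_heineF1 rmorph1 E heineT0.
rewrite -!motzkin_trCM -!motzkin_trD; apply: motzkin_trS.
rewrite [X ^+ m.+1]exprS -[X * _ * _]mulrA fps_coef0M mul0r rmorph0 add0r.
rewrite mulrCA; congr (X * _).
rewrite mulrCA E [X ^+ m.+2]exprS [X ^+ m.+1]exprS; ring.
Qed.

(** The case m = 0 of [heineT_rec], times 1 + X, reads (1 + X)(1 + v X) S_0 = 1 + v (1 - q) X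
    [F_ 1]. *)
Lemma motzkin_tr_heineS n :
  motzkin_tr (heineS F q v 0) n.+1 = v * (1 - q) * motzkin_tr (F_ 1) n.
Proof.
rewrite -motzkin_trCM; apply: motzkin_trS.
have -> : heineS F q v 0 0%N = 1 by rewrite /= big_ord1 !mul1r.
rewrite rmorph1 -[Y in _ = Y + _]heineT0 /F_ (heineT_rec F q v 0).
rewrite !(rmorphB, rmorphM, rmorph1) /=; ring.
Qed.

Lemma coef_heineS0 k : heineS F q v 0 k =
  (-1) ^+ k * \sum_(i < k.+1) v ^+ i * q ^+ (i * (k + 1 - i)).
Proof.
rewrite mulr_sumr; apply: eq_bigr => i _.
have i_k : (i <= k)%N by rewrite -ltnS.
by rewrite !bq1 subnKC // addn1 subSn // !mulr1 mulrCA.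
Qed.

End Moments.

(** This replaces x by x / r; the factor [r ^+ m] keeps the weight of up steps at 1. *)
Lemma path_array_scale (F : fieldType) (b lam : nat -> F) h (r : F) : r != 0 ->
  path_array F b lam h ->
  path_array F (fun m => b m / r) (fun m => lam m / r ^+ 2)
    (fun m n => h m n * r ^+ m / r ^+ n).
Proof.
move=> r0 H m; split=> [|n].
  by rewrite (H m).1 expr0 divr1; case: m => [|m]; rewrite ?mul0r // mulr1.
rewrite (H m).2; case: m => [|m]; rewrite !exprS; field.
all: by rewrite r0 expf_neq0.
Qed.

(** * Closed form for the constant-weight Motzkin paths *)

Section MotzkinClosedForm.
Variables (F : fieldType) (v : F).

(** The coefficient of v^j in [motzkin n k]. A path is a pair of sets of j + k and j steps; by
    reflection, the subtracted product counts the pairs that reach height -1. *)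
Definition motzkin_coef (n k j : nat) : F :=
  ('C(n, j) * 'C(n, j + k))%:R - (binz n (j%:Z - 1) * 'C(n, j + k + 1))%:R.
Local Notation a := motzkin_coef.

Let a0 n k : a n k 0 = 'C(n, k)%:R.
Proof. by rewrite /a /= bin0 mul1n mul0n subr0 add0n. Qed.
Let aS n k j : a n k j.+1 =
  ('C(n, j.+1) * 'C(n, j.+1 + k))%:R - ('C(n, j) * 'C(n, (j + k).+2))%:R.
Proof.
rewrite /a; have -> : (j.+1%:Z - 1 = j)%R by lia.
by rewrite addn1 addSn.
Qed.

Let a_gt n k j : (n < j + k)%N -> a n k j = 0.
Proof.
by move=> nk; rewrite /a addn1 (bin_small nk) (bin_small (leqW nk)) !muln0 subrr.
Qed.

Let a_rec0 n k : a n.+1 k 0 =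
  (if k is k'.+1 then a n k' 0 else 0) + a n k 0.
Proof.
by rewrite !a0; case: k => [|k]; rewrite ?bin0 ?add0r // binS natrD addrC a0.
Qed.

Let a_recS n k j : a n.+1 k j.+1 =
  (if k is k'.+1 then a n k' j.+1 else 0)
  + a n k j.+1 + a n k j + a n k.+1 j.
Proof.
have aE k' j' : a n k' j' = if j' is j.+1 then a n k' j.+1 else 'C(n, k')%:R.
  by case: j' => // *; rewrite a0.
rewrite [a n k j]aE [a n k.+1 j]aE.
case: k => [|k]; case: j {aE} => [|j];
  rewrite !aS ?addnS ?addn0 ?addSn ?add0n !binS ?bin0 ?bin1 !(natrM, natrD);
  ring.
Qed.

(** The bound [N] is free because the induction uses it at two consecutive values, v shifting [j] by
    one. *)
Lemma motzkinE N n k : (n < N)%N ->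
  motzkin F v n k = \sum_(j < N) v ^+ j * a n k j.
Proof.
elim: n N k => [|n IHn] [|N] k //; rewrite ?ltnS => nN.
  rewrite big_ord_recl big1 => [|j _]; last first.
    by rewrite a_gt ?mulr0 // /bump /= add1n addSn.
  by rewrite addr0 mul1r a0 /=; case: k.
rewrite big_ord_recl /=; under eq_bigr do rewrite /bump /= add1n a_recS.
rewrite expr0 mul1r a_rec0.
have E k' : motzkin F v n k' = a n k' 0 + \sum_(j < N) v ^+ j.+1 * a n k' j.+1.
  rewrite (IHn N.+1 k' (leqW nN)) big_ord_recl mul1r; congr (_ + _).
rewrite mulrDl mul1r {1}E (IHn N k) // (IHn N k.+1) // !mulr_sumr.
under [in RHS]eq_bigr do rewrite 3!mulrDr.
rewrite !big_split /=.
have -> : (if k is k'.+1 then motzkin F v n k' else 0) =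
    (if k is k'.+1 then a n k' 0 else 0) +
    \sum_(j < N) v ^+ j.+1 * (if k is k'.+1 then a n k' j.+1 else 0).
  by case: k => [|k]; rewrite ?E // big1 ?addr0 // => j _; rewrite mulr0.
have sE k' : \sum_(j < N) v ^+ j.+1 * a n k' j =
    \sum_(j < N) v * (v ^+ j * a n k' j).
  by apply: eq_bigr => j _; rewrite exprS mulrA.
rewrite !sE; move: (\sum_(j < N) v ^+ j.+1 * (if k is _.+1 then _ else _)).
by move: (if k is _.+1 then _ else _) => x y; ring.
Qed.

Lemma motzkin_closed n k : (k <= n)%N -> motzkin F v n k =
  \sum_(0 <= j < (n - k).+1) v ^+ j * a n k j.
Proof.
move=> kn; rewrite (motzkinE n.+1) //.
rewrite -(big_mkord xpredT (fun j => v ^+ j * a n k j)).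
rewrite (@big_cat_nat _ _ _ (n - k).+1) ?ltnS ?leq_subr //= [X in _ + X]big_nat.
rewrite [X in _ + X]big1 ?addr0 // => j /andP[nkj _].
by rewrite a_gt ?mulr0 //; lia.
Qed.

End MotzkinClosedForm.

(** * D_n at p = 1 in terms of q and v *)

Lemma pq_num1 (F : fieldType) (q : F) m :
  (1 - q) * pq_num 1 q m = 1 - q ^+ m.
Proof.
rewrite /pq_num -opprB mulNr -[1 - q ^+ m]opprB subrX1; congr (- (_ * _)).
rewrite -[RHS](big_mkord xpredT (fun i => q ^+ i)) big_nat_rev /= add0n.
rewrite big_mkord.
by apply: eq_bigr => i _; rewrite expr1n mul1r; congr (q ^+ _); lia.
Qed.

Lemma Dpoly1_motzkin (F : fieldType) (q v t : F) n :
  1 - q != 0 -> 1 + q != 0 -> v != 0 -> 1 + v != 0 ->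
  t = (1 + q) * v / (1 + v) ^+ 2 ->
  Dpoly n.+1 1 q t =
    1 / (v * (1 - q)) * (1 / ((1 + v) * (1 - q))) ^+ n *
    \sum_(k < n.+2) (-1) ^+ k * motzkin F v n.+1 k *
      (\sum_(i < k.+1) v ^+ i * q ^+ (i * (k + 1 - i))).
Proof.
move=> q1 q1' v0 v1 tE; have r0 : (1 + v) * (1 - q) != 0 by rewrite mulf_neq0.
have q2 : 1 - q ^+ 2 != 0.
  by rewrite -(expr1n _ 2) subr_sqr mulf_neq0.
have numE m : pq_num 1 q m = (1 - q ^+ m) / (1 - q).
  by rewrite -pq_num1 mulrC mulKf.
have H := path_array_scale _ _ _ _ _ r0 (path_array_heine F q v).
rewrite /Dpoly -[n.+1.-1]/n.
set h := (h in path_array _ _ _ h) in H.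
have P : path_array F (fun m => pq_num 1 q m.+1)
    (fun m => pq_binomial 1 q m.+1 2 * t) h.
  move=> m; have := H m.
  have -> : (1 + v) * (1 - q ^+ m.+1) / ((1 + v) * (1 - q)) = pq_num 1 q m.+1.
    by rewrite numE; field; rewrite q1 v1.
  (* The denominator [2] = 1 + q of the binomial cancels the factor 1 + q of [t]. *)
  have -> : v * (1 - q ^+ m.+1) * (1 - q ^+ m.+2) / ((1 + v) * (1 - q)) ^+ 2 =
            pq_binomial 1 q m.+2 2 * t.
    rewrite /pq_binomial !big_ord_recr !big_ord0 /= !mul1r subn0 subn1 /= !numE.
    by rewrite tE expr1; field; rewrite q1 v1 q2.
  exact.
rewrite (jfraction_path_array _ _ _ _ P) /h expr0 mulr1 mul1r.
have S := motzkin_tr_heineS F q v n.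
have -> : \sum_(k < n.+2) (-1) ^+ k * motzkin F v n.+1 k *
      (\sum_(i < k.+1) v ^+ i * q ^+ (i * (k + 1 - i))) =
    motzkin_tr F v (heineS F q v 0) n.+1.
  by apply: eq_bigr => k _; rewrite coef_heineS0 mulrCA mulrA.
rewrite {}S !div1r exprVn; field.
by rewrite q1 v0 expf_neq0.
Qed.

(** * Elimination of the square root *)

Lemma sqrt_parametrization (K : fieldType) (q t r : K) :
  2 != 0 :> K -> t != 0 -> r != 0 -> 1 + q != 0 -> q - t * (1 + q) != 0 ->
  r ^+ 2 = (1 + q) ^+ 2 - 4 * t * (1 + q) ->
  let u := (1 + q ^+ 2 - 2 * (1 + q) * t - (1 - q) * r)
             / (2 * (q - t * (1 + q))) in
  let v := ((1 + q) - 2 * t - r) / (2 * t) in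
  [/\ v != 0, 1 + v != 0, t = (1 + q) * v / (1 + v) ^+ 2
    & (1 + u) / (1 + u * v) = (1 + q) / (1 + v)].
Proof.
move=> two t0 r0 q1 d0 r2 u v.
have vE : 2 * t * v = 1 + q - 2 * t - r by rewrite /v; field; rewrite t0 two.
have v0 : v != 0.
  (* The numerator of [v] times its conjugate is (2t)^2, which is nonzero. *)
  apply/eqP => vz; move: vE; rewrite vz mulr0 => /esym E.
  have : (1 + q - 2 * t - r) * (1 + q - 2 * t + r) = (2 * t) ^+ 2.
    by transitivity ((1 + q - 2 * t) ^+ 2 - r ^+ 2); [ring | rewrite r2; ring].
  by move/eqP; rewrite E mul0r eq_sym sqrf_eq0 mulf_eq0 (negbTE two) (negbTE t0).
have v1E : 2 * t * (1 + v) = 1 + q - r by rewrite mulrDr vE; ring.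
have v1 : 1 + v != 0.
  apply/eqP => vz; move: v1E; rewrite vz mulr0 => /esym E.
  have : (1 + q - r) * (1 + q + r) = 2 * 2 * t * (1 + q).
    by transitivity ((1 + q) ^+ 2 - r ^+ 2); [ring | rewrite r2; ring].
  by move/eqP; rewrite E mul0r eq_sym !mulf_eq0 (negbTE two) (negbTE t0) (negbTE q1).
have tE : t * (1 + v) ^+ 2 = (1 + q) * v.
  have h4 : 2 * 2 * t != 0 by rewrite !mulf_neq0.
  apply: (mulfI h4).
  transitivity ((2 * t * (1 + v)) ^+ 2); first by ring.
  rewrite v1E; transitivity (2 * (1 + q) * (2 * t * v)); last by ring.
  rewrite vE; transitivity ((1 + q) ^+ 2 - 2 * (1 + q) * r + r ^+ 2).
    by ring.
  by rewrite r2; ring.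
have tE' : t = (1 + q) * v / (1 + v) ^+ 2.
  by rewrite -tE mulfK // expf_neq0.
have rE : r = (1 + q) * (1 - v) / (1 + v).
  have -> : r = 1 + q - 2 * t * (1 + v) by rewrite v1E; ring.
  by rewrite tE'; field.
split=> //.
(* This factorization makes both q - v and 1 - q v nonzero. *)
have dE : q - t * (1 + q) = (q - v) * (1 - q * v) / (1 + v) ^+ 2.
  by rewrite tE'; field.
move: d0; rewrite dE !mulf_eq0 !negb_or => /andP[/andP[qv qv'] _].
have v1' : 1 - v != 0.
  by apply: contraNneq r0 => E; rewrite rE E mulr0 mul0r.
have uE : u = (q - v) / (1 - q * v).
  rewrite /u dE {1}tE' rE; field.
  by rewrite v1 qv qv' two.
rewrite uE; field.
rewrite v1 qv' /=.
(* The left side is the numerator of 1 + u v. *)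
have -> : 1 - q * v + (q - v) * v = (1 - v) * (1 + v) by ring.
exact: mulf_neq0.
Qed.

Lemma Dpoly1_sqrt (K : fieldType) (q t r : K) n :
  2 != 0 :> K -> t != 0 -> r != 0 -> 1 + q != 0 -> 1 - q != 0 ->
  q - t * (1 + q) != 0 ->
  r ^+ 2 = (1 + q) ^+ 2 - 4 * t * (1 + q) -> (1 <= n)%N ->
  let u := (1 + q ^+ 2 - 2 * (1 + q) * t - (1 - q) * r)
             / (2 * (q - t * (1 + q))) in
  let v := ((1 + q) - 2 * t - r) / (2 * t) in
  Dpoly n 1 q t =
    1 / (v * (1 - q)) * ((1 + u) / ((1 + u * v) * (1 - q ^+ 2))) ^+ n.-1 *
    \sum_(0 <= k < n.+1)
      (-1) ^+ k * (\sum_(0 <= j < (n - k).+1) v ^+ j * motzkin_coef _ n k j) *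
      (\sum_(0 <= i < k.+1) v ^+ i * q ^+ (i * (k + 1 - i))).
Proof.
move=> two t0 r0 q1 q1' d0 r2 n0 u v.
have [v0 v1 tE uE] := sqrt_parametrization K q t r two t0 r0 q1 d0 r2.
rewrite -/u -/v in v0 v1 tE uE.
case: n n0 => // n _; rewrite (Dpoly1_motzkin K q v t) // -[n.+1.-1]/n.
congr (_ * _ ^+ _ * _).
  rewrite [in RHS]invfM mulrA uE -(expr1n _ 2) subr_sqr; field.
  by rewrite q1 q1' v1.
rewrite big_mkord; apply: eq_bigr => k _.
by rewrite motzkin_closed ?big_mkord // -ltnS.
Qed.

(** * Specialization to fractions of power series in t *)

Section FractionSeries.
Variables (K : fieldType) (x : K) (s : {fps K}).
Hypotheses (two : 2 != 0 :> K) (x0 : x != 0).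
Hypotheses (x1 : 1 + x != 0) (x1' : 1 - x != 0).
Hypothesis s2 :
  s ^+ 2 = (1 + fpsC x) ^+ 2 - 4 * fpsX K * (1 + fpsC x).
Hypothesis s0 : s 0%N = (1 + fpsC x) 0%N.

Let tofrac_neq0 (f : {fps K}) : f 0%N != 0 -> tofrac f != 0.
Proof.
by rewrite tofrac_eq0; apply: contraNneq => ->; rewrite fps_coef0.
Qed.

Lemma Dpoly_fraction_series n : (1 <= n)%N ->
  let q := tofrac (fpsC x) in
  let t := tofrac (fpsX K) in
  let r := tofrac s in
  let u := (1 + q ^+ 2 - 2 * (1 + q) * t - (1 - q) * r)
             / (2 * (q - t * (1 + q))) in
  let v := ((1 + q) - 2 * t - r) / (2 * t) in
  Dpoly n 1 q t =
    1 / (v * (1 - q)) * ((1 + u) / ((1 + u * v) * (1 - q ^+ 2))) ^+ n.-1 *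
    \sum_(0 <= k < n.+1)
      (-1) ^+ k * (\sum_(0 <= j < (n - k).+1) v ^+ j * motzkin_coef _ n k j) *
      (\sum_(0 <= i < k.+1) v ^+ i * q ^+ (i * (k + 1 - i))).
Proof.
move=> n0 q t r u v.
(* Apart from [t0], each nonvanishing condition is checked at t = 0. *)
have q1 : 1 + q != 0.
  by rewrite /q -tofrac1 -tofracD tofrac_neq0 // fps_coefD.
have q1' : 1 - q != 0.
  by rewrite /q -tofrac1 -tofracN -tofracD tofrac_neq0 // fps_coefD fps_coefN.
have two' : 2 != 0 :> {fraction {fps K}}.
  by have := tofrac_neq0 (1 + 1) two; rewrite tofracD tofrac1.
have t0 : t != 0.
  rewrite /t tofrac_eq0; apply/eqP => /fpsP /(_ 1%N) /eqP.
  by rewrite fps_coef0 oner_eq0.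
have r0 : r != 0 by rewrite tofrac_neq0 // s0 fps_coefD.
have d0 : q - t * (1 + q) != 0.
  rewrite /q /t -tofrac1 -tofracD -tofracM -tofracN -tofracD tofrac_neq0 //.
  by rewrite fps_coefD fps_coefN fps_coef0M mul0r subr0.
have r2 : r ^+ 2 = (1 + q) ^+ 2 - 4 * t * (1 + q).
  rewrite /r -tofracXn s2 /q /t.
  by rewrite !(rmorphB, rmorphM, rmorphXn, rmorphD, rmorph1, rmorph_nat).
exact: Dpoly1_sqrt.
Qed.

End FractionSeries.

(* The square root in u is multiplied by 1 - q: the case n = 2, where both
   D_2 = 1 and the right-hand side is (1+u)(1+v) / ((1+uv)(1+q)), forces
   u = (q-v) / (1-qv), and this is the value of u below. *)
Theorem theorem3p1 (s : {fps Qq}) (hs : sqrt_branch s) (n : nat)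
    (hn : (1 <= n)%N) :
  let q : Qqt := tofrac qS in
  let t : Qqt := tofrac tS in
  let r : Qqt := tofrac s in
  let u := (1 + q ^+ 2 - 2 * (1 + q) * t - (1 - q) * r)
             / (2 * (q - t * (1 + q))) in
  let v := ((1 + q) - 2 * t - r) / (2 * t) in
  Dpoly n 1 q t =
    1 / (v * (1 - q)) * ((1 + u) / ((1 + u * v) * (1 - q ^+ 2))) ^+ n.-1 *
    \sum_(0 <= k < n.+1)
      (-1) ^+ k *
      (\sum_(0 <= j < (n - k).+1)
         v ^+ j * (('C(n, j) * 'C(n, j + k))%:R
                   - (binz n (j%:Z - 1) * 'C(n, j + k + 1))%:R)) *
      (\sum_(0 <= i < k.+1) v ^+ i * q ^+ (i * (k + 1 - i))).

Proof.
have [s2 s0] := hs.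
have two : (2 : Qq) != 0.
  rewrite -(rmorph_nat (@tofrac {poly rat})) tofrac_eq0 -polyC_natr.
  by rewrite polyC_eq0.
have linear_neq0 (a b : rat) : b != 0 ->
    tofrac (a%:P + b *: 'X : {poly rat}) != 0.
  move=> b0; rewrite tofrac_eq0; apply: contraNneq b0 => /polyP /(_ 1%N).
  by rewrite coefD coefC coefZ coefX coef0 add0r mulr1 => ->.
have x0 : tofrac ('X : {poly rat}) != 0 by rewrite tofrac_eq0 polyX_eq0.
have x1 : 1 + tofrac ('X : {poly rat}) != 0.
  by have := linear_neq0 1 1 isT; rewrite scale1r tofracD polyC1 tofrac1.
have x1' : 1 - tofrac ('X : {poly rat}) != 0.
  have := linear_neq0 1 (-1) isT.
  by rewrite scaleN1r tofracD tofracN polyC1 tofrac1.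
exact: (Dpoly_fraction_series _ _ s two x0 x1 x1' s2 s0 n hn).
Qed.
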